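(* Let $\mathcal F=\{f_1,\ldots,f_n\}$ be a fraction with $n\ge 1$ runs of the full factorial design $\mathcal D=\mathcal D_1\times\cdots\times\mathcal D_m$, and for each $i=1,\ldots,n$ let $R^{(f_i)}=\sum_{\alpha\in L}c_\alpha^{(f_i)}X^\alpha$ be the indicator function of the point $f_i$. Then for every $j=0,\ldots,m$, $$A_j(\mathcal F)=\frac{1}{n^2}\sum_{i=1}^n A_j(f_i)+\frac{(\#\mathcal D)^2}{n^2}\sum_{i_1\neq i_2}\ \sum_{|\alpha|_0=j}c_\alpha^{(f_{i_1})}\,\overline{c_\alpha^{(f_{i_2})}},$$ where the sum over $i_1\ne i_2$ is over all ordered pairs $(i_1,i_2)$ of distinct indices in $\{1,\ldots,n\}$.
   Context: Full factorial design: for $i=1,\ldots,m$ the $s_i$ levels of the $i$-th factor are coded by the $s_i$-th roots of unity, $\mathcal D_i=\{\omega_0^{(s_i)},\ldots,\omega_{s_i-1}^{(s_i)}\}$ with $\omega_k^{(s_i)}=\exp(\sqrt{-1}\,2\pi k/s_i)$, and $\mathcal D=\mathcal D_1\times\cdots\times\mathcal D_m$, with $\#\mathcal D=\prod_{i=1}^m s_i$. A fraction $\mathcal F$ is a (finite) multiset whose elements (runs) lie in $\mathcal D$ (replicates are allowed); its size $n=\#\mathcal F$ is the number of its points counted with multiplicity, and $\mathcal F=\{f_1,\ldots,f_n\}$ lists the points with multiplicity. A single point $f\in\mathcal D$ is regarded as a fraction of size $1$. Let $L=\mathbb Z_{s_1}\times\cdots\times\mathbb Z_{s_m}$ and, for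 $\alpha\in L$ and $\zeta=(\zeta_1,\ldots,\zeta_m)\in\mathcal D$, let $X^\alpha(\zeta)=\zeta_1^{\alpha_1}\cdots\zeta_m^{\alpha_m}$. The functions $X^\alpha$, $\alpha\in L$, form a basis of the complex functions on $\mathcal D$. The counting function $R:\mathcal D\to\mathbb C$ of $\mathcal F$ is the function whose value $R(\zeta)$ is the number of appearances of $\zeta$ in $\mathcal F$; its coefficients $c_\alpha\in\mathbb C$ are defined by $R=\sum_{\alpha\in L}c_\alpha X^\alpha$. The counting function of a single point $f$ is its indicator function $R^{(f)}$ (equal to $1$ at $f$ and $0$ elsewhere on $\mathcal D$), with coefficients denoted $c_\alpha^{(f)}$. Let $|\alpha|_0$ be the number of non-zero components of $\alpha$. The Generalized Word-Length Pattern (GWLP) of $\mathcal F$ is the vector $(A_0(\mathcal F),\ldots,A_m(\mathcal F))$ with $$A_j(\mathcal F)=\sum_{|\alpha|_0=j}\left(\frac{|c_\alpha|}{c_0}\right)^2,\qquad c_0=c_{(0,\ldots,0)}=\frac{n}{\#\mathcal D},$$ where $|c_\alpha|$ is the modulus of $c_\alpha$. *)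

(* Defs.v *)
From HB Require Import structures.
From mathcomp Require Import all_boot all_order all_algebra.
From mathcomp Require Import complex.
From mathcomp Require Import boolp classical_sets reals trigo.

Set Implicit Arguments.
Unset Strict Implicit.
Unset Printing Implicit Defensive.

Import Order.TTheory GRing.Theory Num.Theory.

Local Open Scope ring_scope.

Definition omega (R : realType) (s k : nat) : R[i] :=
  let t := 2 * pi * k%:R / s%:R in (cos t +i* sin t)%C.

Definition levels (R : realType) (s : nat) : seq R[i] :=
  [seq omega R s k | k <- iota 0 s].

Notation point R m := {ffun 'I_m -> R[i]}.

Definition design (R : realType) (m : nat) (s : 'I_m -> nat) :
    {pred point R m} :=
  [pred z : point R m | [forall i, z i \in levels R (s i)]].
Arguments design R {m} s.

Definition card_design (m : nat) (s : 'I_m -> nat) : nat := (\prod_i s i)%N.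

(* The index set L; Z_(s i) is represented by its residues 0, ..., s i - 1,
   which are the exponents used in X^alpha ('Z_n would not be Z/n for n = 1). *)
Notation expo s := {dffun forall i, 'I_(s i)}.

Definition expo0 (m : nat) (s : 'I_m -> nat) (s_gt0 : forall i, (0 < s i)%N) :
    expo s :=
  [ffun i => Ordinal (s_gt0 i)].

Definition norm0 (m : nat) (s : 'I_m -> nat) (a : expo s) : nat :=
  #|[set i | (a i != 0 :> nat)%N]|.

Definition monom (R : realType) (m : nat) (s : 'I_m -> nat) (a : expo s)
    (z : point R m) : R[i] :=
  \prod_i z i ^+ a i.

(* A fraction is given by the list F of its runs, with multiplicity. *)
Definition counting (R : realType) (m : nat) (F : seq (point R m))
    (z : point R m) : R[i] :=
  (count_mem z F)%:R.

Definition is_coef (R : realType) (m : nat) (s : 'I_m -> nat)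
    (g : point R m -> R[i]) (c : {ffun expo s -> R[i]}) : Prop :=
  {in design R s, forall z, g z = \sum_(a : expo s) c a * monom a z}.

(* By coefP and is_coef_inj below, this is the unique family satisfying
   is_coef, so that the default value 0 of xget is never used. *)
Definition coef (R : realType) (m : nat) (s : 'I_m -> nat)
    (g : point R m -> R[i]) : {ffun expo s -> R[i]} :=
  xget 0 [set c | is_coef g c]%classic.

(* Valued in R[i], where `|_| is the modulus seen as a complex number. *)
Definition gwlp (R : realType) (m : nat) (s : 'I_m -> nat)
    (s_gt0 : forall i, (0 < s i)%N) (F : seq (point R m)) (j : nat) : R[i] :=
  let c := coef s (counting F) in
  \sum_(a : expo s | norm0 a == j) (`|c a| / c (expo0 s_gt0)) ^+ 2.

Lemma omega1X (R : realType) (s k : nat) : omega R s 1 ^+ k = omega R s k.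
Proof.
elim: k => [|k IH]; first by rewrite expr0 /omega mulr0n mulr0 mul0r cos0 sin0.
rewrite exprSr IH /omega mulr1n mulr1; apply/eqP; rewrite eq_complex /=.
have -> : 2 * pi * k.+1%:R / s%:R = 2 * pi * k%:R / s%:R + 2 * pi / s%:R :> R.
  by rewrite -[k.+1%:R]natr1 mulrDr mulr1 mulrDl.
by rewrite cosD sinD eqxx addrC eqxx.
Qed.

Lemma omega_period (R : realType) (s : nat) : (0 < s)%N -> omega R s s = 1.
Proof.
move=> s0; rewrite /omega mulfK ?pnatr_eq0 -?lt0n //.
rewrite mulr_natl cos_mulr2n sin_mulr2n cospi sinpi mulr0 mul0rn.
by rewrite sqrrN expr1n mulr2n addrK.
Qed.

Lemma omega_neq1 (R : realType) (s k : nat) :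
  (0 < k < s)%N -> omega R s k != 1.
Proof.
move=> /andP[k0 ks]; have s0 : 0 < s%:R :> R by rewrite ltr0n (leq_trans _ ks).
apply/eqP => -[]; set t := pi * k%:R / s%:R : R.
have -> : 2 * pi * k%:R / s%:R = t *+ 2 :> R by rewrite -[RHS]mulr_natl /t !mulrA.
have : 0 < sin t.
  have s1 : (0 < s)%N by exact: ltn_trans ks.
  apply: sin_gt0_pi; rewrite /t divr_gt0 ?mulr_gt0 ?pi_gt0 ?ltr0n //=.
  by rewrite ltr_pdivrMr // ltr_pM2l ?pi_gt0 // ltr_nat.
rewrite cos_mulr2n cos2sin2 => st /eqP.
rewrite mulrnBl subr_eq -[1 *+ 2]/(1 + 1) -[X in _ == X]addr0.
by rewrite (inj_eq (addrI _)) oppr_eq0 mulrn_eq0 /= sqrf_eq0 gt_eqF //.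
Qed.

Lemma sum_omega (R : realType) (s : nat) (b c : 'I_s) :
  \sum_(a < s) omega R s b ^+ a / omega R s c ^+ a / s%:R = (b == c)%:R.
Proof.
have s0 : (0 < s)%N by exact: leq_trans (ltn_ord b).
have w0 k : omega R s k != 0.
  rewrite -omega1X expf_neq0 //; apply/eqP => w0.
  by have := omega_period R s0; rewrite -omega1X w0 expr0n gtn_eqF //= => /eqP;
    rewrite eq_sym oner_eq0.
under eq_bigr do rewrite -expr_div_n.
have [<-|bc] := eqVneq b c.
  rewrite divff //; under eq_bigr do rewrite expr1n mul1r.
  by rewrite sumr_const card_ord -[_ *+ _]mulr_natl divff // pnatr_eq0 -lt0n.
rewrite -mulr_suml; set z := omega R s b / omega R s c.
have zs : z ^+ s = 1.
  have ws k : omega R s k ^+ s = 1.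
    by rewrite -omega1X -exprM mulnC exprM omega1X omega_period // expr1n.
  by rewrite /z expr_div_n !ws divr1.
have z1 : z != 1.
  have aux (d e : 'I_s) : (d < e)%N -> omega R s d != omega R s e.
    move=> de; rewrite -(subnKC (ltnW de)) -(omega1X _ s d).
    rewrite -(omega1X _ s (_ + _)) exprD.
    rewrite -[X in X == _]mulr1 (inj_eq (mulfI _)) ?omega1X // eq_sym.
    by rewrite omega_neq1 // subn_gt0 de (leq_ltn_trans (leq_subr _ _)).
  rewrite -(inj_eq (mulIf (w0 c))) mul1r divfK //.
  move: bc; rewrite -val_eqE neq_ltn => /orP[]/aux //.
  by rewrite eq_sym.
suff -> : \sum_(a < s) z ^+ a = 0 by rewrite mul0r.
apply/eqP; rewrite -(inj_eq (mulfI (_ : z - 1 != 0))) ?subr_eq0 //.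
by rewrite mulr0 -subrX1 zs subrr.
Qed.

Lemma sum_expo (K : comPzSemiRingType) (m : nat) (s : 'I_m -> nat)
    (F : forall i, 'I_(s i) -> K) :
  \sum_(a : expo s) \prod_i F i (a i) = \prod_i \sum_(k < s i) F i k.
Proof.
have bij := @dffun_of_fprod_bij _ (fun i => 'I_(s i) : finType).
rewrite (reindex _ (onW_bij _ bij)) /=.
under eq_bigr do under eq_bigr do rewrite ffunE.
pose P i := [ffun k : 'I_(s i) => F i k].
transitivity (\sum_(t : fprod (fun i => 'I_(s i) : finType))
   \prod_(i in 'I_m) P i (t i)).
  by apply: eq_bigr => t _; apply: eq_bigr => i _; rewrite ffunE.
rewrite big_fprod.
rewrite -(bigA_distr_big_dep _ (fun i => untag 0 (P i))).
apply: eq_bigr => i _; transitivity (\sum_k P i k).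
  by rewrite [RHS](big_tag (fun i k => P i k)).
by apply: eq_bigr => k _; rewrite ffunE.
Qed.

Definition expo_point (R : realType) (m : nat) (s : 'I_m -> nat) (b : expo s) :
    point R m :=
  [ffun i => omega R (s i) (b i)].

Lemma designP (R : realType) (m : nat) (s : 'I_m -> nat) (z : point R m) :
  reflect (exists b : expo s, z = expo_point R b) (z \in design R s).
Proof.
apply: (iffP forallP) => [H|[b ->] i]; last first.
  by rewrite ffunE; apply: map_f; rewrite mem_iota /= add0n.
have H' i : exists k : 'I_(s i), z i == omega R (s i) k.
  by have /mapP[k] := H i; rewrite mem_iota add0n /= => ks ->; exists (Ordinal ks).
exists [ffun i => xchoose (H' i)]; apply/ffunP => i; rewrite !ffunE.
exact/eqP/(xchooseP (H' i)).
Qed.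

Lemma sum_monom (R : realType) (m : nat) (s : 'I_m -> nat) (b c : expo s) :
  \sum_(a : expo s)
     monom a (expo_point R b) / monom a (expo_point R c) / (card_design s)%:R
  = (b == c)%:R.
Proof.
transitivity (\sum_(a : expo s) \prod_i
    (omega R (s i) (b i) ^+ a i / omega R (s i) (c i) ^+ a i / (s i)%:R)).
  apply: eq_bigr => a _; rewrite /monom /card_design natr_prod -!prodf_div.
  by apply: eq_bigr => i _; rewrite !ffunE.
rewrite (@sum_expo _ _ _ (fun i k =>
  omega R (s i) (b i) ^+ k / omega R (s i) (c i) ^+ k / (s i)%:R)).
under eq_bigr do rewrite sum_omega.
have [->|bc] := eqVneq b c; first by rewrite big1 // => i _; rewrite eqxx.
have /existsP[i bci] : [exists i, b i != c i].
  rewrite -negb_forall; apply: contraNN bc => /forallP H.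
  by apply/eqP/ffunP => i; apply/eqP.
by rewrite (bigD1 i) //= (negPf bci) mul0r.
Qed.

Lemma monomC (R : realType) (m : nat) (s : 'I_m -> nat) (a b : expo s) :
  monom a (expo_point R b) = monom b (expo_point R a).
Proof.
apply: eq_bigr => i _.
by rewrite !ffunE -[in LHS]omega1X -[in RHS]omega1X -!exprM mulnC.
Qed.

Lemma is_coef_ex (R : realType) (m : nat) (s : 'I_m -> nat)
    (g : point R m -> R[i]) : exists c, is_coef (s := s) g c.
Proof.
exists [ffun a => \sum_(c : expo s)
  g (expo_point R c) / monom a (expo_point R c) / (card_design s)%:R].
move=> _ /designP[b ->].
under eq_bigr do rewrite ffunE mulr_suml.
rewrite exchange_big /=; under eq_bigr => c _.
  rewrite (eq_bigr (fun a => g (expo_point R c) * (monom a (expo_point R b)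
    / monom a (expo_point R c) / (card_design s)%:R))); last first.
    by move=> a _; rewrite -!mulrA; congr (_ * _); rewrite mulrA mulrC.
  rewrite -mulr_sumr sum_monom; over.
rewrite (bigD1 b) //= eqxx mulr1 big1 ?addr0 // => c cb.
by rewrite eq_sym (negPf cb) mulr0.
Qed.

Lemma is_coef_inj (R : realType) (m : nat) (s : 'I_m -> nat)
    (g : point R m -> R[i]) (c d : {ffun expo s -> R[i]}) :
  is_coef g c -> is_coef g d -> c = d.
Proof.
suff H (e : {ffun expo s -> R[i]}) :
    is_coef g e -> forall a, e a = \sum_(b : expo s)
    g (expo_point R b) / monom a (expo_point R b) / (card_design s)%:R.
  by move=> cP dP; apply/ffunP => a; rewrite (H c) // (H d).
move=> eP a.
transitivity (\sum_(b : expo s) \sum_(a' : expo s) e a' *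
    (monom b (expo_point R a') / monom b (expo_point R a)
     / (card_design s)%:R)).
  rewrite exchange_big /= (bigD1 a) //= -mulr_sumr sum_monom eqxx mulr1.
  rewrite big1 ?addr0 // => a' aa'.
  by rewrite -mulr_sumr sum_monom (negPf aa') mulr0.
apply: eq_bigr => b _; rewrite eP; last by apply/designP; exists b.
rewrite !mulr_suml; apply: eq_bigr => a' _.
by rewrite (monomC _ a') (monomC _ a) !mulrA.
Qed.

Lemma coefP (R : realType) (m : nat) (s : 'I_m -> nat)
    (g : point R m -> R[i]) : is_coef g (coef s g).
Proof.
have [c cP] := is_coef_ex s g; exact: (xgetI 0 cP).
Qed.

(* Main.v *)
Require Import Defs.
From mathcomp Require Import all_boot all_order all_algebra.
From mathcomp Require Import complex.
From mathcomp Require Import reals.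

Import GRing.Theory Num.Theory.
Local Open Scope ring_scope.

(** Up to the factor [(#D / n) ^ 2], the number [A_j(F)] is the sum of
    [|c_a| ^ 2] over the exponents [a] of weight [j], because the constant
    coefficient of the counting function is [n / #D] ([coef_counting0]).  The
    counting function of [F] is the sum of the indicator functions of its runs,
    and taking coefficients is linear, so [c_a] is the sum of the [c_a] of the
    runs ([coef_counting_sum]).  Expanding the squared modulus of this sum as a
    double sum ([sqr_norm_sum]), the diagonal terms are the word-length patterns
    of the runs, each divided by [(#D) ^ 2], and the other terms are the mixed
    products of the statement. *)

(** The orthogonality of characters separates the points: the sum in
    [sum_monom] depends on [b] only through its point. *)
Lemma expo_point_inj (R : realType) (m : nat) (s : 'I_m -> nat) :
  injective (@expo_point R m s).
Proof.
move=> b c bc; have := sum_monom R b c.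
rewrite bc sum_monom eqxx; case: eqVneq => // _ /eqP.
by rewrite oner_eq0.
Qed.

Lemma coef_unique {R : realType} {m : nat} {s : 'I_m -> nat}
    {g : point R m -> R[i]} {c : {ffun expo s -> R[i]}} :
  is_coef g c -> coef s g = c.
Proof. exact/is_coef_inj/coefP. Qed.

(** Both sides expand the counting function of [F], which is the sum of the
    indicator functions of its runs, and expansions are unique. *)
Lemma coef_counting_sum (R : realType) (m : nat) (s : 'I_m -> nat)
    (F : seq (point R m)) (a : expo s) :
  coef s (counting F) a = \sum_(z <- F) coef s (counting [:: z]) a.
Proof.
pose c := [ffun a' : expo s => \sum_(z <- F) coef s (counting [:: z]) a'].
suff cP : is_coef (counting F) c by rewrite (coef_unique cP) ffunE.
move=> y yD; transitivity (\sum_(z <- F) counting [:: z] y).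
  rewrite /counting -natr_sum -sum1_count big_mkcond /=.
  by congr _%:R; apply: eq_bigr => z _; case: (z == y).
under eq_bigr do rewrite (coefP _ yD).
by rewrite exchange_big; apply: eq_bigr => a' _; rewrite ffunE mulr_suml.
Qed.

(** This is the discrete Fourier transform of a point mass: by orthogonality of
    the characters ([sum_monom]), the family on the right expands the indicator
    function of [z], and such an expansion is unique. *)
Lemma coef_counting1 (R : realType) (m : nat) (s : 'I_m -> nat)
    (z : point R m) (a : expo s) :
  z \in design R s ->
  coef s (counting [:: z]) a = (monom a z)^-1 / (card_design s)%:R.
Proof.
move=> /designP[b ->].
pose c := [ffun a' : expo s =>
  (monom a' (expo_point R b))^-1 / (card_design s)%:R].
suff cP : is_coef (counting [:: expo_point R b]) c.
  by rewrite (coef_unique cP) ffunE.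
move=> _ /designP[d ->]; rewrite /counting /= addn0.
rewrite (inj_eq (expo_point_inj _ _ _)).
rewrite eq_sym -(sum_monom R); apply: eq_bigr => a' _.
by rewrite ffunE -mulrA mulrC.
Qed.

Lemma coef_counting0 (R : realType) (m : nat) (s : 'I_m -> nat)
    (s_gt0 : forall i, (0 < s i)%N) (F : seq (point R m)) :
  {subset F <= design R s} ->
  coef s (counting F) (expo0 s_gt0) = (size F)%:R / (card_design s)%:R.
Proof.
move=> FD; rewrite coef_counting_sum big_seq.
under eq_bigr => z zF.
  rewrite coef_counting1 ?FD // [monom _ _]big1 ?invr1 ?mul1r; first over.
  by move=> i _; rewrite ffunE expr0.
by rewrite -big_seq big_const_seq count_predT iter_addr_0 -[LHS]mulr_natl.
Qed.

Lemma gwlpE (R : realType) (m : nat) (s : 'I_m -> nat)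
    (s_gt0 : forall i, (0 < s i)%N) (F : seq (point R m)) (j : nat) :
  {subset F <= design R s} ->
  gwlp s_gt0 F j = (card_design s)%:R ^+ 2 / (size F)%:R ^+ 2 *
    \sum_(a : expo s | norm0 a == j) `|coef s (counting F) a| ^+ 2.
Proof.
move=> FD; rewrite /gwlp mulr_sumr; apply: eq_bigr => a _.
by rewrite coef_counting0 // invf_div exprMn expr_div_n mulrC.
Qed.

Lemma sqr_norm_sum (C : numClosedFieldType) (I : finType) (x : I -> C) :
  `|\sum_i x i| ^+ 2 =
    \sum_i `|x i| ^+ 2 + \sum_i \sum_(k | i != k) x i * (x k)^*.
Proof.
rewrite normCK rmorph_sum mulr_suml -big_split /=; apply: eq_bigr => i _.
rewrite mulr_sumr (bigD1 i) //= normCK; congr (_ + _).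
by apply: eq_bigl => k; rewrite eq_sym.
Qed.

Theorem proposition3p4 (R : realType) (m : nat) (s : 'I_m -> nat)
    (s_gt0 : forall i : 'I_m, (0 < s i)%N)
    (n : nat) (n_gt0 : (0 < n)%N)
    (f : n.-tuple (point R m))
    (f_design : forall i : 'I_n, tnth f i \in design R s)
    (j : nat) (j_le_m : (j <= m)%N) :
  gwlp s_gt0 f j =
    1 / n%:R ^+ 2 * (\sum_(i < n) gwlp s_gt0 [:: tnth f i] j)
    + (card_design s)%:R ^+ 2 / n%:R ^+ 2 *
      \sum_(i1 < n) \sum_(i2 < n | i1 != i2)
        \sum_(a : expo s | norm0 a == j)
          coef s (counting [:: tnth f i1]) a *
          (coef s (counting [:: tnth f i2]) a)^*.
Proof.
have fD : {subset f <= design R s} by move=> _ /tnthP[i ->].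
have -> : \sum_(i < n) gwlp s_gt0 [:: tnth f i] j = (card_design s)%:R ^+ 2 *
    \sum_(i < n) \sum_(a : expo s | norm0 a == j)
      `|coef s (counting [:: tnth f i]) a| ^+ 2.
  rewrite mulr_sumr; apply: eq_bigr => i _.
  rewrite gwlpE ?expr1n ?divr1 // => z.
  by rewrite inE => /eqP ->.
rewrite gwlpE // size_tuple div1r mulrA [_^-1 * _]mulrC -mulrDr; congr (_ * _).
under eq_bigr do rewrite coef_counting_sum big_tuple sqr_norm_sum.
rewrite big_split /=; congr (_ + _); first exact: exchange_big.
by rewrite exchange_big; apply: eq_bigr => i1 _; rewrite exchange_big.
Qed.
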